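(* Let $A=\{1,2\}$ and let $n,d,e\in\mathbb{N}$ be such that both players are middle class, i.e. $M_1(n)\le d<U_1(n)$ and $M_2(n)\le e<U_2(n)$. Then the winner of $\mathrm{NIM}(A;n;d,e)$ is determined as follows. 1. $n\equiv 0\pmod 6$: - for every integer $k\ge 0$: if $M_1(n)+k\le d<M_1(n)+k+1$ and $e<M_2(n)+k+1$, then $W(n;d,e)=1$; if $M_1(n)+k\le d<M_1(n)+k+1$ and $e\ge M_2(n)+k+1$, then $W(n;d,e)=2$; - if $d\ge U_1(n)-1$ and $e<U_2(n)-1$, then $W(n;d,e)=1$; if $d\ge U_1(n)-1$ and $e\ge U_2(n)-1$, then $W(n;d,e)=2$. 2. $n\equiv 1,5\pmod 6$: - if $d<M_1(n)+1$, then $W(n;d,e)=2$; - for every integer $k\ge 0$: if $M_1(n)+k+1\le d<M_1(n)+k+2$ and $e<M_2(n)+k+1$, then $W(n;d,e)=1$; if $M_1(n)+k+1\le d<M_1(n)+k+2$ and $e\ge M_2(n)+k+1$, then $W(n;d,e)=2$; - if $d\ge U_1(n)-1$, then $W(n;d,e)=1$. 3. $n\equiv 2,4\pmod 6$: - for every integer $k\ge 0$: if $M_1(n)+k\le d<M_1(n)+k+1$ and $e<M_2(n)+k+1$, then $W(n;d,e)=1$; if $M_1(n)+k\le d<M_1(n)+k+1$ and $e\ge M_2(n)+k+1$, then $W(n;d,e)=2$; - if $d\ge U_1(n)-1$, then $W(n;d,e)=1$. 4. $n\equiv 3\pmod 6$: - if $d<M_1(n)+1$, then $W(n;d,e)=2$;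 - for every integer $k\ge 0$: if $M_1(n)+k+1\le d<M_1(n)+k+2$ and $e<M_2(n)+k+1$, then $W(n;d,e)=1$; if $M_1(n)+k+1\le d<M_1(n)+k+2$ and $e\ge M_2(n)+k+1$, then $W(n;d,e)=2$; - if $d\ge U_1(n)-1$ and $e<U_2(n)-1$, then $W(n;d,e)=1$; if $d\ge U_1(n)-1$ and $e\ge U_2(n)-1$, then $W(n;d,e)=2$.
   Context: $\mathbb{N}=\{0,1,2,\dots\}$. In the game $\mathrm{NIM}(A;n)$ two players alternate (Player 1 first) removing some $a\in A$ stones from a pile of $n$ stones ($a$ may not exceed the number of stones left); a player who cannot move loses. $W(n)\in\{1,2\}$ is the player with a winning strategy. In the NIM with Cash game $\mathrm{NIM}(A;n;d,e)$, Player 1 starts with $d$ dollars and Player 2 with $e$ dollars. Players alternate, Player 1 first; a move consists of removing some $a\in A$ stones and paying $a$ dollars, where $a$ may exceed neither the number of stones left nor the mover's money. A player who cannot move on his turn loses. $W(n;d,e)\in\{1,2\}$ is the player with a winning strategy. The upper class amounts $U_1(n),U_2(n)\in\mathbb{N}$ are defined recursively (depending on $A$): - If $n<\min(A)$, then $U_1(n)=U_2(n)=0$. - If $n\ge\min(A)$ and $W(n)=1$, then $U_1(n)=\min\{U_2(n-a)+a : a\in A,\ a\le n,\ W(n-a)=2\}$ and $U_2(n)=\max\{U_1(n-a): a\in A,\ a\le n\}$. - If $n\ge\min(A)$ and $W(n)=2$, then $U_2(n)=\max\{U_1(n-a): a\in A,\ a\le n\}$ and $U_1(n)=\min\{U_2(n-a)+a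 : a\in A,\ a\le n,\ U_1(n-a)=U_2(n)\}$. The middle class thresholds are $M_1(n)=\frac n2+1$, $M_2(n)=\frac n2$ for $n$ even, and $M_1(n)=M_2(n)=\frac{n+1}{2}$ for $n$ odd. Player $i$ is middle class when his money is at least $M_i(n)$ and less than $U_i(n)$. *)

(* Defs.v *)
From HB Require Import structures.
From mathcomp Require Import all_boot.
From Stdlib Require Import ClassicalEpsilon.
Set Implicit Arguments.
Unset Strict Implicit.
Unset Printing Implicit Defensive.

Inductive player : Type := P1 | P2.

Definition other (i : player) : player := if i is P1 then P2 else P1.

Definition player_eqb (i j : player) : bool :=
  match i, j with P1, P1 | P2, P2 => true | _, _ => false end.

Lemma player_eqP : Equality.axiom player_eqb.
Proof. by case; case; constructor. Qed.

HB.instance Definition _ := hasDecEq.Build player player_eqP.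

(* A two-player alternating game in which a player who cannot move loses.
   [legal i x a]: on his turn at [x], player [i] may make the move [a], which
   leads to the position [next i x a]. *)
Record game : Type := Game {
  pos : Type;
  legal : player -> pos -> nat -> bool;
  next : player -> pos -> nat -> pos
}.

(* Strategies are functions of the position: when every move removes at least
   one stone, no position occurs twice in a play, so memory is redundant. *)
Definition is_strategy (G : game) (i : player) (s : pos G -> nat) : Prop :=
  forall x, (exists a, legal i x a) -> legal i x (s x).

(* [outcome s j x w]: the play in which each player [i] follows [s i], started
   at [x] with [j] to move, ends after finitely many moves and is won by [w]. *)
Inductive outcome (G : game) (s : player -> pos G -> nat) :
    player -> pos G -> player -> Prop :=
| outcome_stuck j x :
    (forall a, ~~ legal j x a) -> outcome s j x (other j)
| outcome_move j x w :
    legal j x (s j x) -> outcome s (other j) (next j x (s j x)) w ->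
    outcome s j x w.

Definition profile (G : game) (i : player) (s t : pos G -> nat) :
    player -> pos G -> nat :=
  fun j => if j == i then s else t.

Definition winning_strategy (G : game) (i : player) (x : pos G)
    (s : pos G -> nat) : Prop :=
  is_strategy i s /\
  forall t, is_strategy (other i) t -> outcome (profile i s t) P1 x i.

Definition has_winning_strategy (G : game) (x : pos G) (i : player) : Prop :=
  exists s, winning_strategy i x s.

(* The default value is irrelevant for the games below when 0 is not a move:
   see [nim_winnerP] and [cash_winnerP]. *)
Definition winner (G : game) (x : pos G) : player :=
  epsilon (inhabits P1) (has_winning_strategy x).

Definition nim (A : seq nat) : game :=
  @Game nat (fun _ n a => (a \in A) && (a <= n)) (fun _ n a => n - a).

Record cash_pos : Type := CashPos { stones : nat; cash1 : nat; cash2 : nat }.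

Definition cash (i : player) (x : cash_pos) : nat :=
  if i is P1 then cash1 x else cash2 x.

Definition nim_cash (A : seq nat) : game :=
  @Game cash_pos
    (fun i x a => [&& a \in A, a <= stones x & a <= cash i x])
    (fun i x a =>
       if i is P1 then CashPos (stones x - a) (cash1 x - a) (cash2 x)
       else CashPos (stones x - a) (cash1 x) (cash2 x - a)).

Definition W (A : seq nat) (n : nat) : player := @winner (nim A) n.

Definition Wcash (A : seq nat) (n d e : nat) : player :=
  @winner (nim_cash A) (CashPos n d e).

(* The least element of a nonempty sequence (0 for the empty one). *)
Definition seqmin (s : seq nat) : nat := foldr minn (head 0 s) s.

(* [upper_rec A k n] is the pair (U_1(n), U_2(n)) as soon as [n < k], provided
   0 is not in [A]; [upperE] is the recursion without fuel. *)
Fixpoint upper_rec (A : seq nat) (k n : nat) : nat * nat :=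
  if k is k'.+1 then
    if n < seqmin A then (0, 0) else
    let u1 a := (upper_rec A k' (n - a)).1 in
    let u2 a := (upper_rec A k' (n - a)).2 in
    let v2 := \max_(a <- A | a <= n) u1 a in
    match W A n with
    | P1 =>
      (seqmin [seq u2 a + a | a <- A & (a <= n) && (W A (n - a) == P2)], v2)
    | P2 =>
      (seqmin [seq u2 a + a | a <- A & (a <= n) && (u1 a == v2)], v2)
    end
  else (0, 0).

Definition U1 (A : seq nat) (n : nat) : nat := (upper_rec A n.+1 n).1.
Definition U2 (A : seq nat) (n : nat) : nat := (upper_rec A n.+1 n).2.

(* n/2 + 1 or (n+1)/2, and n/2 or (n+1)/2, according to the parity of n; the
   halves are exact in each case. *)
Definition M1 (n : nat) : nat := if odd n then n.+1./2 else n./2 + 1.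
Definition M2 (n : nat) : nat := if odd n then n.+1./2 else n./2.

Lemma otherK : involutive other. Proof. by case. Qed.

Lemma other_neq i : (other i == i) = false. Proof. by case: i. Qed.

Lemma outcome_inj (G : game) (s : player -> pos G -> nat) j x w w' :
  outcome s j x w -> outcome s j x w' -> w = w'.
Proof.
move=> H; elim: H w' => {j x w} [j x stuck | j x w leg _ IH] w' H'.
  by inversion H' as [? ? | ? ? ? leg']; subst => //; rewrite (negPf (stuck _)) in leg'.
inversion H' as [? ? stuck | ? ? ? ? out]; subst; last exact: IH.
by rewrite (negPf (stuck _)) in leg.
Qed.

Lemma eq_outcome (G : game) (s s' : player -> pos G -> nat) j x w :
  s =2 s' -> outcome s j x w -> outcome s' j x w.
Proof.
move=> eqs; elim=> {j x w} [j x stuck | j x w leg _ IH].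
  exact: outcome_stuck.
by apply: outcome_move; rewrite -eqs.
Qed.

Lemma has_winning_strategy_inj (G : game) (x : pos G) i j :
  has_winning_strategy x i -> has_winning_strategy x j -> i = j.
Proof.
move=> [s [sP sW]] [t [tP tW]].
case: (eqVneq i j) => // nij.
have ej : j = other i by case: i j nij {sP sW tP tW} => -[].
subst j; apply: outcome_inj (sW t tP) _.
have := tW s; rewrite otherK => /(_ sP); apply: eq_outcome => k y.
by rewrite /profile; case: i k {sP sW tP tW nij} => -[].
Qed.

Section Determinacy.

Variables (G : game) (A : seq nat) (m : pos G -> nat).
Hypothesis legal_mem : forall i (x : pos G) a, legal i x a -> a \in A.
Hypothesis next_lt : forall i (x : pos G) a, legal i x a -> m (next i x a) < m x.

Fixpoint value (k : nat) (j : player) (x : pos G) : player :=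
  if k is k'.+1 then
    if has (fun a => legal j x a && (value k' (other j) (next j x a) == j)) A
    then j else other j
  else other j.

Let good i (x : pos G) a :=
  legal i x a && (value (m x) (other i) (next i x a) == i).
Let best i (x : pos G) : nat :=
  if has (good i x) A then nth 0 A (find (good i x) A)
  else nth 0 A (find (legal i x) A).

Lemma value_fuel k l j x : m x < k -> m x < l -> value k j x = value l j x.
Proof.
elim: k l j x => // k IH [//|l] j x mk ml /=.
congr (if _ then _ else _); apply: eq_in_has => a _.
case: (boolP (legal j x a)) => //= leg; congr (_ == _).
by apply: IH; apply: (leq_trans (next_lt leg)).
Qed.

Let best_strategy i : is_strategy i (best i).
Proof.
move=> x [a leg]; rewrite /best; case: ifP => [h | _].
  by have /andP[] := nth_find 0 h.
by apply: nth_find; apply/hasP; exists a => //; apply: legal_mem leg.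
Qed.

Let best_outcome i t : is_strategy (other i) t ->
  forall k j x, m x < k -> value (m x).+1 j x = i ->
  outcome (profile i (best i) t) j x i.
Proof.
move=> tP; elim=> // k IH j x mk vx.
have step : legal j x (profile i (best i) t j x) ->
    value (m x) (other j) (next j x (profile i (best i) t j x)) = i ->
    outcome (profile i (best i) t) j x i.
  move=> leg v; have lt := next_lt leg; apply: outcome_move leg _.
  apply: IH; first exact: leq_trans lt mk.
  by apply: etrans v; apply: value_fuel.
case: (eqVneq j i) => [ej | nj].
  subst j; move: vx => /=; case: ifP => [h _ | _ /eqP]; last by rewrite other_neq.
  have /andP[leg /eqP v] := nth_find 0 h.
  by apply: step; rewrite /profile eqxx /best /good h.
have ej : j = other i by case: j i nj {IH tP step vx} => -[].
subst j; have et : profile i (best i) t (other i) = t.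
  by rewrite /profile other_neq.
move: vx => /=; case: ifP => [_ /eqP | /negbT/hasPn h _].
  by rewrite other_neq.
case: (boolP (has (legal (other i) x) A)) => [/hasP[a _ leg] | /hasPn no].
  have legt : legal (other i) x (t x) by apply: tP; exists a.
  apply: step; rewrite et //.
  have := h _ (legal_mem legt); rewrite legt /= otherK.
  by case: (value _ _ _); case: (i).
have := @outcome_stuck G (profile i (best i) t) (other i) x.
rewrite otherK; apply=> a; apply/negP => leg.
by move: (no _ (legal_mem leg)); rewrite leg.
Qed.

Lemma determined (x : pos G) : exists i, has_winning_strategy x i.
Proof.
exists (value (m x).+1 P1 x); eexists; split; first exact: best_strategy.
by move=> t tP; apply: (best_outcome tP (ltnSn (m x))).
Qed.

Lemma winnerP (x : pos G) i : winner x = i <-> has_winning_strategy x i.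
Proof.
have H := epsilon_spec (inhabits P1) _ (determined x).
by split=> [<- // | Hi]; apply: has_winning_strategy_inj H Hi.
Qed.

End Determinacy.

Lemma nim_winnerP A n i : 0 \notin A ->
  W A n = i <-> @has_winning_strategy (nim A) n i.
Proof.
move=> A0; apply: (@winnerP (nim A) A id) => /= [_ x a /andP[] // | _ x a].
case/andP=> aA ax; case: a aA ax => [|a] aA ax; first by rewrite aA in A0.
by rewrite ltn_subrL /= (leq_trans _ ax).
Qed.

Lemma cash_winnerP A n d e i : 0 \notin A ->
  Wcash A n d e = i <-> @has_winning_strategy (nim_cash A) (CashPos n d e) i.
Proof.
move=> A0.
apply: (@winnerP (nim_cash A) A stones) => /= [_ x a /and3P[] // | j x a].
case/and3P=> aA ax _; case: a aA ax => [|a] aA ax; first by rewrite aA in A0.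
by case: j => /=; rewrite ltn_subrL /= (leq_trans _ ax).
Qed.

Lemma upper_rec_fuel A k l n : 0 \notin A -> n < k -> n < l ->
  upper_rec A k n = upper_rec A l n.
Proof.
move=> A0; elim: k l n => // k IH [//|l] n nk nl /=; case: ifP => // _.
have E a : a \in A -> a <= n -> upper_rec A k (n - a) = upper_rec A l (n - a).
  case: a => [|a] aA an; first by rewrite aA in A0.
  have lt : n - a.+1 < n by rewrite ltn_subrL /= (leq_trans _ an).
  by apply: IH; apply: leq_trans lt _.
have Emax : \max_(a <- A | a <= n) (upper_rec A k (n - a)).1 =
            \max_(a <- A | a <= n) (upper_rec A l (n - a)).1.
  rewrite big_seq_cond [RHS]big_seq_cond; apply: eq_bigr => a /andP[aA an].
  by rewrite E.
rewrite Emax; case: (W A n); congr (seqmin _, _).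
  by apply/eq_in_map => a; rewrite mem_filter => /andP[/andP[an _] aA]; rewrite E.
rewrite (@eq_in_filter _ _ (fun a => (a <= n) && ((upper_rec A l (n - a)).1 ==
  \max_(a0 <- A | a0 <= n) (upper_rec A l (n - a0)).1))); last first.
  by move=> a aA; case: (boolP (a <= n)) => //= an; rewrite E.
by apply/eq_in_map => a; rewrite mem_filter => /andP[/andP[an _] aA]; rewrite E.
Qed.

Lemma upperE A n : 0 \notin A ->
  (U1 A n, U2 A n) =
    if n < seqmin A then (0, 0) else
    let v2 := \max_(a <- A | a <= n) U1 A (n - a) in
    match W A n with
    | P1 => (seqmin [seq U2 A (n - a) + a |
                      a <- A & (a <= n) && (W A (n - a) == P2)], v2)
    | P2 => (seqmin [seq U2 A (n - a) + a |
                      a <- A & (a <= n) && (U1 A (n - a) == v2)], v2)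
    end.
Proof.
move=> A0; rewrite {1}/U1 {1}/U2 -surjective_pairing.
rewrite (@upper_rec_fuel A n.+1 n.+2) //.
change (upper_rec A n.+2 n) with
    (if n < seqmin A then (0, 0) else
    let u1 a := (upper_rec A n.+1 (n - a)).1 in
    let u2 a := (upper_rec A n.+1 (n - a)).2 in
    let v2 := \max_(a <- A | a <= n) u1 a in
    match W A n with
    | P1 =>
      (seqmin [seq u2 a + a | a <- A & (a <= n) && (W A (n - a) == P2)], v2)
    | P2 =>
      (seqmin [seq u2 a + a | a <- A & (a <= n) && (u1 a == v2)], v2)
    end).
have E a : upper_rec A n.+1 (n - a) = upper_rec A (n - a).+1 (n - a).
  by apply: upper_rec_fuel => //; rewrite ltnS leq_subr.
case: ifP => // _; cbv zeta.
have Emax : \max_(a <- A | a <= n) (upper_rec A n.+1 (n - a)).1 =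
            \max_(a <- A | a <= n) U1 A (n - a).
  by apply: eq_bigr => a _; rewrite E.
rewrite Emax; case: (W A n); congr (seqmin _, _).
  by apply: eq_map => a; rewrite E.
rewrite (@eq_filter _ _ (fun a => (a <= n) && (U1 A (n - a) ==
  \max_(a0 <- A | a0 <= n) U1 A (n - a0)))) => [|a]; last by rewrite E.
by apply: eq_map => a; rewrite E.
Qed.

(* Main.v *)
Require Import Defs.
From mathcomp Require Import all_boot.
From mathcomp Require Import zify.
From Stdlib Require Import ClassicalEpsilon.

(* Put u = 2 (n / 3) + n mod 3, which is U_1(n). For all amounts m of the mover
   and o of his opponent, a mover with m < u wins iff o < m, while a mover with
   m >= u wins iff n mod 3 <> 0 or o < u. In particular two middle class players
   are ranked by their money: Player 1 wins iff e < d. *)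

Section WinningPositions.

Variables (G : game) (m : pos G -> nat) (win : player -> pos G -> bool).
Hypothesis next_lt : forall i (x : pos G) a, legal i x a -> m (Defs.next i x a) < m x.
Hypothesis win_move : forall i (x : pos G), win i x ->
  exists a, legal i x a /\ ~~ win (other i) (Defs.next i x a).
Hypothesis lose_move : forall i (x : pos G) a, ~~ win i x -> legal i x a ->
  win (other i) (Defs.next i x a).

(** The predicted winner [i] keeps the invariant that [win] holds for the player to move exactly
    when that player is [i]. As [m] decreases, the play ends, and [win_move] lets it end only on the
    opponent's turn. *)
Lemma winner_win (x : pos G) : winner x = if win P1 x then P1 else P2.
Proof.
set i := if _ then _ else _.
(* The condition is an implication because a strategy must also give a legal move in positions lost
   for [i]. *)
pose s (y : pos G) := epsilon (inhabits 0)
  (fun a => legal i y a /\ (win i y -> ~~ win (other i) (Defs.next i y a))).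
have sP y : (exists a, legal i y a) ->
    legal i y (s y) /\ (win i y -> ~~ win (other i) (Defs.next i y (s y))).
  move=> [a leg]; apply: (epsilon_spec (inhabits 0)
    (fun a => legal i y a /\ (win i y -> ~~ win (other i) (Defs.next i y a)))).
  case: (boolP (win i y)) => [w | _]; last by exists a.
  by have [b [legb lb]] := win_move _ _ w; exists b.
have out t : is_strategy (other i) t -> forall k j y, m y < k ->
    win j y = (j == i) -> outcome (profile i s t) j y i.
  move=> tP; elim=> // k IH j y yk.
  case: (eqVneq j i) => [-> | nj] wy.
    have [legs ls] : legal i y (s y) /\ (win i y -> ~~ win (other i) (Defs.next i y (s y))).
      by apply: sP; have [a [leg _]] := win_move _ _ wy; exists a.
    have es : profile i s t i = s by rewrite /profile eqxx.
    apply: outcome_move; rewrite es //.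
    apply: IH; first exact: leq_trans (next_lt _ _ _ legs) yk.
    by rewrite other_neq; apply/negbTE/ls.
  have ej : j = other i by case: j i nj {s sP tP IH wy} => -[].
  subst j; have et : profile i s t (other i) = t by rewrite /profile other_neq.
  case: (excluded_middle_informative (exists a, legal (other i) y a)) => [lega | no].
    have legt := tP _ lega.
    apply: outcome_move; rewrite et //.
    apply: IH; first exact: leq_trans (next_lt _ _ _ legt) yk.
    by rewrite otherK eqxx -[X in win X](otherK i) lose_move ?wy.
  rewrite -[X in outcome _ _ _ X]otherK; apply: outcome_stuck => a.
  by apply/negP => leg; apply: no; exists a.
have wi : has_winning_strategy x i.
  exists s; split=> [y /sP[] // | t tP].
  by apply: (out t tP (m x).+1) => //; rewrite /i; case: (win P1 x).
apply: has_winning_strategy_inj (wi).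
by apply: epsilon_spec; exists i.
Qed.

End WinningPositions.

Lemma W12 n : W [:: 1; 2] n = if n %% 3 == 0 then P2 else P1.
Proof.
rewrite /W (@winner_win (nim [:: 1; 2]) id (fun _ n => n %% 3 != 0)); first by case: (_ == _).
- by move=> _ x a /=; rewrite !inE; lia.
(* Removing the nonzero remainder leaves a multiple of 3. *)
- move=> _ x /= wx; exists (x %% 3); rewrite !inE; lia.
- by move=> _ x a /=; rewrite !inE; lia.
Qed.

(** [u] dollars always pay for the plain NIM strategy: [n %% 3] at first, then at most 2 in each of
    [n %/ 3] rounds that remove 3 stones together. *)
Definition mover_wins (n m o : nat) : bool :=
  let u := 2 * (n %/ 3) + n %% 3 in
  (o < minn m u) || (n %% 3 != 0) && (u <= m).

Lemma Wcash12 n d e :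
  Wcash [:: 1; 2] n d e = if mover_wins n d e then P1 else P2.
Proof.
rewrite /Wcash (@winner_win (nim_cash [:: 1; 2]) stones
  (fun i x => mover_wins (stones x) (cash i x) (cash (other i) x))) //.
- by case=> -[x c1 c2] a /=; rewrite !inE; lia.
- have move_to n' m' o' : mover_wins n' m' o' -> exists a, [/\ (a == 1) || (a == 2),
      a <= n', a <= m' & ~~ mover_wins (n' - a) o' (m' - a)].
    (* In a winning position one stone is a wrong move only if [n' %% 3 = 2], the mover has at least
       [u] and the opponent at least [u - 1]; then two stones win. *)
    case: (boolP [&& 0 < n', 0 < m' & ~~ mover_wins (n' - 1) o' (m' - 1)]).
      by case/and3P=> n0 m0 l _; exists 1.
    by move=> h w; exists 2; move: h w; rewrite /mover_wins /=; split; lia.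
  by case=> -[n' d' e'] /= /move_to[a [aA an ad l]]; exists a; split=> //; rewrite !inE aA an.
- have lose n' m' o' a : ~~ mover_wins n' m' o' -> (a == 1) || (a == 2) ->
      a <= n' -> a <= m' -> mover_wins (n' - a) o' (m' - a).
    by rewrite /mover_wins /=; lia.
  by case=> -[n' d' e'] a /= l; rewrite !inE => /and3P[]; apply: lose.
Qed.

(** From two stones on both moves are legal, and in each residue class modulo 3 the filter under
    [seqmin] keeps a single move. *)
Lemma U12 n : U1 [:: 1; 2] n = 2 * (n %/ 3) + n %% 3 /\
  U2 [:: 1; 2] n = 2 * (n %/ 3) + (n %% 3)./2.
Proof.
elim/ltn_ind: n => n IH; have := @upperE [:: 1; 2] n isT.
case: n IH => [|[|n]] IH; rewrite W12 /=.
- by [].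
- have [e1 e2] := IH 0 isT.
  by rewrite !big_cons big_nil /= W12 subnn /= e1 e2 => -[-> ->].
have [e1 e2] := IH n.+1 (ltnSn _).
have [f1 f2] := IH n (leqnSn _); clear IH.
rewrite !big_cons big_nil /= !subSS !subn0 !W12 e1 f1 maxn0.
have [r|[r|r]] : n %% 3 = 0 \/ n %% 3 = 1 \/ n %% 3 = 2 by lia.
- rewrite r /= (_ : n.+2 %% 3 == 0 = false); last lia.
  rewrite (_ : n.+1 %% 3 == 0 = false) /=; last lia.
  rewrite !subSS subn0 f2 => -[-> ->]; rewrite /seqmin /=; lia.
- rewrite (_ : n.+2 %% 3 == 0 = true); last lia.
  (* With [q = n %/ 3], [U1] is [2 * q + 2] at [n.+1] and [2 * q + 1] at [n]: only removing one
     stone attains the maximum. *)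
  rewrite (maxn_idPl _); last lia.
  rewrite eqxx (_ : (_ + n %% 3 == _) = false); last lia.
  rewrite /= subSS subn0 e2 => -[-> ->]; rewrite /seqmin /=; lia.
- rewrite r /= (_ : n.+2 %% 3 == 0 = false); last lia.
  rewrite (_ : n.+1 %% 3 == 0 = true) /=; last lia.
  rewrite subSS subn0 e2 => -[-> ->]; rewrite /seqmin /=; lia.
Qed.

Theorem theorem6p3 (n d e : nat) :
  let A := [:: 1; 2] in
  M1 n <= d < U1 A n ->
  M2 n <= e < U2 A n ->
  [/\ (n %% 6 = 0 ->
        (forall k : nat, M1 n + k <= d < M1 n + k + 1 ->
          (e < M2 n + k + 1 -> Wcash A n d e = P1) /\
          (M2 n + k + 1 <= e -> Wcash A n d e = P2)) /\
        (U1 A n - 1 <= d ->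
          (e < U2 A n - 1 -> Wcash A n d e = P1) /\
          (U2 A n - 1 <= e -> Wcash A n d e = P2))),
      (n %% 6 = 1 \/ n %% 6 = 5 ->
        [/\ (d < M1 n + 1 -> Wcash A n d e = P2),
            (forall k : nat, M1 n + k + 1 <= d < M1 n + k + 2 ->
              (e < M2 n + k + 1 -> Wcash A n d e = P1) /\
              (M2 n + k + 1 <= e -> Wcash A n d e = P2)) &
            (U1 A n - 1 <= d -> Wcash A n d e = P1)]),
      (n %% 6 = 2 \/ n %% 6 = 4 ->
        (forall k : nat, M1 n + k <= d < M1 n + k + 1 ->
          (e < M2 n + k + 1 -> Wcash A n d e = P1) /\
          (M2 n + k + 1 <= e -> Wcash A n d e = P2)) /\
        (U1 A n - 1 <= d -> Wcash A n d e = P1)) &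
      (n %% 6 = 3 ->
        [/\ (d < M1 n + 1 -> Wcash A n d e = P2),
            (forall k : nat, M1 n + k + 1 <= d < M1 n + k + 2 ->
              (e < M2 n + k + 1 -> Wcash A n d e = P1) /\
              (M2 n + k + 1 <= e -> Wcash A n d e = P2)) &
            (U1 A n - 1 <= d ->
              (e < U2 A n - 1 -> Wcash A n d e = P1) /\
              (U2 A n - 1 <= e -> Wcash A n d e = P2))])].
Proof.
(* Rounding merges the even and odd cases of each threshold. *)
have -> : M1 n = n./2 + 1 by rewrite /M1; case: ifP; lia.
have -> : M2 n = n.+1./2 by rewrite /M2; case: ifP; lia.
move=> A; have [-> ->] := U12 n; rewrite Wcash12 => dP eP.
have -> : mover_wins n d e = (e < d) by rewrite /mover_wins; lia.
(* The clauses in [k] compare [e] with [d], as [M1 - M2] is 1 for even [n] and 0 for odd [n]. In the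
   last clauses [d = U1 - 1], and [U2] is [U1] if 3 divides [n] and [U1 - 1] otherwise. *)
do ![split | move=> ?]; case: (ltnP e d) => // ?; lia.
Qed.
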